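(* Let $P$ be a probability measure in $\mathcal{P}_2(\mathbb{R})$. Let $\mathcal{C}$ be a non-empty perturbation class characterized by a set of $K$ quantile constraints, that is, $$\mathcal{C}=\left\{Q\in\mathcal{P}(\mathbb{R}) \mid F_Q^{\leftarrow}(\alpha_i)\le b_i\le F_Q^{\rightarrow}(\alpha_i),\ i=1,\dots,K\right\},$$ where $K\in\mathbb{N}^*$, $(\alpha_1,\dots,\alpha_K)\in[0,1]^K$ and $(b_1,\dots,b_K)\in\mathbb{R}^K$. Assume, without loss of generality, that $\alpha_1<\dots<\alpha_K$ along with $b_1<\dots<b_K$. Let $\beta_i=F_P(b_i)$ for $i=1,\dots,K$. Define the intervals $A_i=(c_i,d_i]$ for $i=1,\dots,K$, such that $$c_1=\min(\beta_1,\alpha_1),\qquad c_i=\min\bigl[\max(\alpha_{i-1},\beta_i),\alpha_i\bigr],\quad i=2,\dots,K,$$ $$d_K=\max(\beta_K,\alpha_K),\qquad d_j=\max\bigl[\min(\beta_j,\alpha_{j+1}),\alpha_j\bigr],\quad j=1,\dots,K-1.$$ Let $A=\bigcup_{i=1}^K A_i$ and $\overline{A}=[0,1]\setminus A$. Then the problem $$F_Q^{\leftarrow}=\underset{L\in L^2([0,1])}{\text{argmin}}\ \int_0^1\bigl(L(x)-F_P^{\rightarrow}(x)\bigr)^2dx\quad\text{s.t.}\quad L(\alpha_i)\le b_i\le L(\alpha_i^+),\ i=1,\dots,K,\quad L\in\mathcal{F}^{\leftarrow},$$ has a unique solution, which can be written as, for any $y\in[0,1]$, $$F_Q^{\leftarrow}(y)=\begin{cases}F_P^{\rightarrow}(y)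 & \text{if } y\in\overline{A},\\ b_i & \text{if } y\in A_i,\quad i=1,\dots,K.\end{cases}$$
   Context: $\mathcal{P}(\mathbb{R})$ is the set of probability measures on $\mathbb{R}$ and $\mathcal{P}_2(\mathbb{R})$ is the subset of those with finite second moment. For $P\in\mathcal{P}(\mathbb{R})$, $F_P(t)=P((-\infty,t])$ is its cumulative distribution function. The generalized quantile function of $P$ is the left-continuous, non-decreasing generalized inverse of $F_P$, defined for every $a\in(0,1)$ by $F_P^{\leftarrow}(a)=\sup\{t\in\mathbb{R}\mid F_P(t)<a\}=\inf\{t\in\mathbb{R}\mid F_P(t)\ge a\}$. The right-continuous non-decreasing generalized inverse is defined for every $a\in(0,1)$ by $F_P^{\rightarrow}(a)=\sup\{t\in\mathbb{R}\mid F_P(t)\le a\}=\inf\{t\in\mathbb{R}\mid F_P(t)>a\}=F_P^{\leftarrow}(a^+)$, where $F_P^{\leftarrow}(a^+)=\lim_{x\to a^+}F_P^{\leftarrow}(x)$. It is almost everywhere equal to $F_P^{\leftarrow}$. $\mathcal{F}^{\leftarrow}$ is the set of functions $(0,1)\to\mathbb{R}$ that are left-continuous and non-decreasing, and $L(a^+)$ is the right limit of $L$ at $a$. Levels $\alpha_i$ equal to $0$ or $1$ are allowed, and no separate convention is specified for the values of these functions at $0$ and $1$. Each function in $\mathcal{F}^{\leftarrow}$ is the generalized quantile function of a unique probability measure on $\mathbb{R}$. The solution $F_Q^{\leftarrow}$ characterizes the projection $Q$ of $P$ onto $\mathcal{C}$ for the 2-Wasserstein distance $W_2(P,Q)=\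bigl(\int_0^1(F_P^{\rightarrow}(x)-F_Q^{\rightarrow}(x))^2dx\bigr)^{1/2}$.
   Formalization: Outside A, equality with the right-continuous inverse of F_P fails at its jumps, so it is proved for almost every y, and for every y in [0,1] with the left-continuous inverse; at levels 0 and 1 the conventions L(0) = -∞, L(1) = L(1-), L(1+) = +∞ are used. *)

(* Defs.v *)
From mathcomp Require Import all_boot all_order all_algebra.
From mathcomp Require Import all_classical all_reals all_analysis.

Set Implicit Arguments.
Unset Strict Implicit.
Unset Printing Implicit Defensive.

Import Order.TTheory GRing.Theory Num.Theory.
Import numFieldNormedType.Exports.

Local Open Scope classical_set_scope.
Local Open Scope ring_scope.

Definition law (R : realType) := probability (measurableTypeR R) R.

Definition cdf_of (R : realType) (P : law R) (t : R) : R :=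
  fine (P `]-oo, t]%classic).

Definition finite_second_moment (R : realType) (P : law R) : Prop :=
  (\int[P]_x (x ^+ 2)%:E < +oo)%E.

(* The two generalized inverses of the cdf are taken in the extended reals, so
   that they make sense at every level a in [0, 1]. They are finite on ]0, 1[;
   at the ends, lquantile P 0 = -oo and rquantile P 1 = +oo, whereas
   rquantile P 0 and lquantile P 1 are the (possibly infinite) bounds of the
   support of P. *)
Definition lquantile (R : realType) (P : law R) (a : R) : \bar R :=
  ereal_sup [set t%:E | t in [set t : R | cdf_of P t < a]].

Definition rquantile (R : realType) (P : law R) (a : R) : \bar R :=
  ereal_sup [set t%:E | t in [set t : R | cdf_of P t <= a]].

Definition perturbation_class (R : realType) (K : nat) (alpha b : 'I_K -> R) :
    set (law R) :=
  [set Q | forall i, (lquantile Q (alpha i) <= (b i)%:E)%E /\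
                     ((b i)%:E <= rquantile Q (alpha i))%E].

(* Left-continuous non-decreasing functions ]0, 1[ -> R, represented by total
   functions R -> R whose values outside ]0, 1[ are irrelevant. *)
Definition left_cont_nondecr (R : realType) (L : R -> R) : Prop :=
  {in `]0, 1[ &, {homo L : x y / x <= y}} /\
  {in `]0, 1[, forall a : R, L x @[x --> a^'-] --> L a}.

Definition square_integrable01 (R : realType) (L : R -> R) : Prop :=
  measurable_fun (`]0, 1[%classic : set R) L /\
  (\int[lebesgue_measure]_(x in `]0%R, 1%R[) (L x ^+ 2)%:E < +oo)%E.

(* L(a) and L(a+) for a in [0, 1]. Beyond ]0, 1[, the conventions are those
   satisfied by quantile functions: L(0) = -oo, L(1) = L(1-), L(1+) = +oo. *)
Definition value_at (R : realType) (L : R -> R) (a : R) : \bar R :=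
  if a == 0 then -oo%E
  else if a == 1 then lim ((L x)%:E @[x --> (1 : R)^'-])
  else (L a)%:E.

Definition right_limit_at (R : realType) (L : R -> R) (a : R) : \bar R :=
  if a == 1 then +oo%E else lim ((L x)%:E @[x --> a^'+]).

Definition admissible (R : realType) (K : nat) (alpha b : 'I_K -> R)
    (L : R -> R) : Prop :=
  [/\ square_integrable01 L, left_cont_nondecr L &
      forall i, (value_at L (alpha i) <= (b i)%:E)%E /\
                ((b i)%:E <= right_limit_at L (alpha i))%E].

Definition objective (R : realType) (P : law R) (L : R -> R) : \bar R :=
  (\int[lebesgue_measure]_(x in `]0%R, 1%R[)
     ((L x - fine (rquantile P x)) ^+ 2)%:E)%E.

Definition is_argmin (R : realType) (P : law R) (K : nat)
    (alpha b : 'I_K -> R) (L : R -> R) : Prop :=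
  admissible alpha b L /\
  forall L', admissible alpha b L' -> (objective P L <= objective P L')%E.

(* ord_pred and ordS are cyclic on 'I_K; they are only used here away from the
   index where they would wrap around. *)
Definition lower_end (R : realType) (P : law R) (K : nat)
    (alpha b : 'I_K -> R) (i : 'I_K) : R :=
  let beta j := cdf_of P (b j) in
  if i == 0 :> nat then Num.min (beta i) (alpha i)
  else Num.min (Num.max (alpha (ord_pred i)) (beta i)) (alpha i).

Definition upper_end (R : realType) (P : law R) (K : nat)
    (alpha b : 'I_K -> R) (j : 'I_K) : R :=
  let beta i := cdf_of P (b i) in
  if j.+1 == K then Num.max (beta j) (alpha j)
  else Num.max (Num.min (beta j) (alpha (ordS j))) (alpha j).

Definition Aset (R : realType) (P : law R) (K : nat) (alpha b : 'I_K -> R)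
    (i : 'I_K) : set R :=
  `]lower_end P alpha b i, upper_end P alpha b i]%classic.

Definition piecewise_at (R : realType) (P : law R) (K : nat)
    (alpha b : 'I_K -> R) (g q : R -> \bar R) (y : R) : Prop :=
  ((~ (\bigcup_i Aset P alpha b i) y) -> q y = g y) /\
  (forall i, Aset P alpha b i y -> q y = (b i)%:E).

(* Main.v *)
From HB Require Import structures.
Require Import Defs.
From mathcomp Require Import all_boot all_order all_algebra.
From mathcomp Require Import all_classical all_reals all_analysis.
From mathcomp Require Import measurable_realfun ring.

Set Implicit Arguments.
Unset Strict Implicit.
Unset Printing Implicit Defensive.

Import Order.TTheory GRing.Theory Num.Theory.
Import numFieldNormedType.Exports.

Local Open Scope classical_set_scope.
Local Open Scope ring_scope.

(** The minimisation over functions is really a minimisation at each level.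
    A non-decreasing [L] satisfies the constraints if and only if it lies, on
    the open unit interval, between two step functions: [lower_bnd], which at
    [y] is the largest [b i] with [alpha i < y], and [upper_bnd], the smallest
    [b i] with [y <= alpha i] ([constraintsP]).  Among the values allowed at
    level [y], the one nearest to the quantile of [P] is its truncation
    [clamp] to the interval they bound, so the truncated quantile is optimal
    as soon as it is itself a square-integrable left-continuous non-decreasing
    function.

    That it is the quantile function of a law comes from a Galois connection.
    A quantile function is determined by the equivalence
    [lquantile P y <= t <-> y <= cdf_of P t] ([lquantile_le]), valid for all
    real [y] and [t].  Conversely, two functions so related, the first one
    finite on the open unit interval and the second one with values in the
    closed unit interval, are the quantile and distribution functions of the
    image of the uniform law by the first one ([law_of_galois]).  Truncation
    preserves the connection, the adjoint being the explicit [clamp_cdf]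
    ([clamp_galois]).  Applied to [P] itself, [law_of_galois] also transports
    integrals from [P] to the unit interval, which gives square integrability
    of the quantile function, hence of its truncation.

    Uniqueness is the obtuse-angle characterisation of projections on convex
    sets: pointwise, [(L' - L) * (L - q) >= 0] when [L] is the truncation of
    [q] and [L'] is admissible, hence the squared distances satisfy
    [d(q, L) + d(L, L') <= d(q, L')] ([clamp_pythagoras]).  Two minimisers are
    thus equal almost everywhere, and everywhere by left-continuity
    ([ae_eq_left_cont]).

    The piecewise formula reads off the truncation: on [A_i], [b i] is one of
    the two bounds and the quantile of [P] is equal to it or out of bounds
    ([clamp_eq_b]), and elsewhere the quantile already lies between the
    bounds ([clamp_eq_lquantile]).  The left and right quantiles of [P] differ
    only at values taken by the distribution function at rational points,
    hence on a countable set ([ae_lquantile_rquantile]); this accounts for the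
    formula with the right quantile holding almost everywhere. *)

(** * Distribution functions *)

Section cdf.
Context {R : realType} (P : law R).
Local Notation F := (cdf_of P).

Let idTR : measurableTypeR R -> R := idfun.

#[local] HB.instance Definition _ :=
  @isMeasurableFun.Build _ _ _ _ idTR (@measurable_id _ _ setT).

Let id_RV : {RV P >-> R} := idTR.

Lemma cdf_ofE t : (F t)%:E = cdf id_RV t.
Proof. by rewrite fineK// fin_num_measure. Qed.

Lemma cdf_of_ge0 t : 0 <= F t.
Proof. by rewrite -lee_fin cdf_ofE cdf_ge0. Qed.

Lemma cdf_of_le1 t : F t <= 1.
Proof. by rewrite -lee_fin cdf_ofE cdf_le1. Qed.

Lemma cdf_of_homo : {homo F : s t / s <= t}.
Proof. by move=> s t st; rewrite -lee_fin !cdf_ofE cdf_nondecreasing. Qed.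

Lemma cdf_of_right_continuous t : F s @[s --> t^'+] --> F t.
Proof.
apply: fine_cvg; rewrite fineK ?fin_num_measure//.
exact: (@cdf_right_continuous _ _ _ P id_RV).
Qed.

Lemma cvg_cdf_ofy : F @ +oo%R --> (1 : R).
Proof. exact/fine_cvg/(cvg_cdfy1 id_RV). Qed.

Lemma cvg_cdf_ofNy : F @ -oo%R --> (0 : R).
Proof. exact/fine_cvg/(cvg_cdfNy0 id_RV). Qed.

End cdf.

(** * Left and right quantiles *)

Section quantile.
Context {R : realType} (P : law R).
Local Notation F := (cdf_of P).

(** The Galois connection between quantile and distribution functions. It
    rests on right-continuity of the latter: if [F t < y], then [F s < y] for
    some [s > t], so the supremum exceeds [t]. *)
Lemma lquantile_le (y t : R) : (lquantile P y <= t%:E)%E = (y <= F t).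
Proof.
apply/idP/idP => [lqt|yFt]; last first.
  apply/ereal_supP => _ [s /= Fsy <-]; rewrite lee_fin leNgt; apply/negP => ts.
  by have := lt_le_trans Fsy yFt; rewrite ltNge cdf_of_homo// ltW.
rewrite leNgt; apply/negP => Fty.
have : \forall s \near t^'+, F s < y.
  exact: (cvgr_lt _ (@cdf_of_right_continuous _ P t)).
move=> Hn.
near t^'+ => s.
have Fsy : F s < y by near: s.
have : (s%:E <= lquantile P y)%E by apply: ereal_sup_ubound; exists s.
move=> /le_trans/(_ lqt); rewrite lee_fin leNgt => /negP; apply.
by near: s; exact: nbhs_right_gt.
Unshelve. all: by end_near. Qed.

Lemma lquantile_fin_num (y : R) : 0 < y < 1 -> lquantile P y \is a fin_num.
Proof.
move=> /andP[y0 y1].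
have [t Ft] : exists t, y <= F t.
  near (pinfty_nbhs R) => t; exists t.
  near: t; exact: (cvgr_ge _ (@cvg_cdf_ofy _ P)).
have [s Fs] : exists s, F s < y.
  near (ninfty_nbhs R) => s; exists s.
  near: s; exact: (cvgr_lt _ (@cvg_cdf_ofNy _ P)).
rewrite fin_real//; apply/andP; split.
  rewrite ltNge; apply/negP => lqNy.
  by move: Fs; rewrite ltNge -lquantile_le (le_trans lqNy)// leNye.
by rewrite (@le_lt_trans _ _ t%:E) ?ltry// lquantile_le.
Unshelve. all: by end_near. Qed.

Lemma lquantile_homo : {homo lquantile P : x y / x <= y >-> (x <= y)%E}.
Proof.
move=> x y xy; apply: ereal_sup_le => _ [t /= Ft <-].
by exists t => //=; exact: lt_le_trans xy.
Qed.

Lemma rquantile_homo : {homo rquantile P : x y / x <= y >-> (x <= y)%E}.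
Proof.
move=> x y xy; apply: ereal_sup_le => _ [t /= Ft <-].
by exists t => //=; exact: le_trans xy.
Qed.

Lemma lquantile_le_rquantile (y : R) : (lquantile P y <= rquantile P y)%E.
Proof.
by apply: ereal_sup_le => _ [t /= Ft <-]; exists t => //=; exact: ltW.
Qed.

Lemma lt_rquantile (y t : R) : (t%:E < rquantile P y)%E -> F t <= y.
Proof.
move=> /ereal_sup_gt[_ [s /= Fs <-]]; rewrite lte_fin => ts.
by rewrite (le_trans _ Fs)// cdf_of_homo// ltW.
Qed.

Lemma lte_rat_between (x y : \bar R) : (x < y)%E ->
  exists q : rat, (x < (ratr q)%:E < y)%E.
Proof.
move: x y => [x| |] [y| |] //=.
- by rewrite lte_fin => /rat_in_itvoo[q]; rewrite in_itv/= => xqy; exists q.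
- move=> _; have [q] : exists q : rat, ratr q \in `]x, (x + 1)[.
    by apply: rat_in_itvoo; rewrite ltrDl.
  by rewrite in_itv/= => /andP[xq _]; exists q; rewrite lte_fin xq ltry.
- move=> _; have [q] : exists q : rat, ratr q \in `](y - 1), y[.
    by apply: rat_in_itvoo; rewrite gtrBl.
  by rewrite in_itv/= => /andP[_ qy]; exists q; rewrite lte_fin qy ltNyr.
- by move=> _; exists 0; rewrite ltNyr ltry.
Qed.

(** A rational [q] strictly between the two quantiles at [y] forces
    [F q = y]: the left quantile gives [y <= F q], the right one [F q <= y].
    The two quantiles thus agree off a countable set. *)
Lemma ae_lquantile_rquantile :
  {ae lebesgue_measure, forall y : R, lquantile P y = rquantile P y}.
Proof.
exists (range (fun q : rat => F (ratr q))).
have cA : countable (range (fun q : rat => F (ratr q))).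
  by apply: sub_countable (countableP setT); exact: card_image_le.
split.
- exact: countable_measurable.
- exact: countable_lebesgue_measure0.
move=> y /= lry.
have lr : (lquantile P y < rquantile P y)%E.
  by rewrite lt_neqAle lquantile_le_rquantile andbT; apply/eqP.
have [q /andP[lq qr]] := lte_rat_between lr.
exists q => //; apply/eqP; rewrite eq_le lt_rquantile//=.
by rewrite -lquantile_le ltW.
Qed.

End quantile.

(** * Measurability and equality of laws *)

Section measurability.
Context {R : realType}.

Lemma nondecreasing_emeasurable (f : R -> \bar R) :
  {homo f : x y / x <= y >-> (x <= y)%E} -> measurable_fun [set: R] f.
Proof.
move=> ndf _; apply: (measurability _ (ErealGenCInfty.measurableE R)) => //.
move=> _ [_ [r ->] <-]; rewrite setTI; apply: is_interval_measurable.
move=> x y /= fx fy z /andP[xz zy]; move: fx; rewrite /= !in_itv/= !andbT => fx.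
exact: (le_trans fx (ndf _ _ xz)).
Qed.

(** The open right half-lines generate the Borel sets and are stable under
    intersection; total mass one gives their measure from that of the closed
    left half-lines. *)
Lemma law_eq (P Q : law R) : cdf_of P =1 cdf_of Q ->
  forall A, measurable A -> P A = Q A.
Proof.
move=> PQ A mA.
have PQc (t : R) : P `]-oo, t]%classic = Q `]-oo, t]%classic.
  rewrite -[LHS]fineK ?fin_num_measure// -[RHS]fineK ?fin_num_measure//.
  by congr EFin; exact: PQ.
have mA' : <<s @RGenOInfty.G R >> A by move: mA; rewrite RGenOInfty.measurableE.
apply: (@g_sigma_algebra_measure_unique _ R (measurableTypeR R)
  (@RGenOInfty.G R) _ (fun n => `](- n%:R : R), +oo[%classic) _ _ P Q _ _ _ A mA').
- by move=> _ [x ->]; exact: measurable_itv.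
- by move=> n; eexists.
- rewrite -subTset => x _; exists (Num.bound `|x|) => //=.
  by rewrite in_itv/= andbT ltrNl (le_lt_trans (ler_norm _))// normrN Num.Theory.archi_boundP.
- move=> _ _ [x ->] [y ->]; exists (Num.max x y).
  by apply/seteqP; split => z /=; rewrite !in_itv/= !andbT gt_max => /andP.
- move=> _ [x ->]; rewrite -setCitvl.
  transitivity (1 - P `]-oo, x]%classic)%E; last rewrite PQc;
    [|apply: esym]; exact: probability_setC.
- by move=> n; rewrite (le_lt_trans (probability_le1 _ _)) ?ltry.
Qed.
End measurability.

(** * Realising a Galois connection as the quantile function of a law *)

Section law_of_galois.
Context {R : realType}.
Local Notation mu := (@lebesgue_measure R).

(** Extended reals are compared through their real upper bounds, the only ones
    that a Galois connection sees. *)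
Lemma lee_ubounds (x y : \bar R) :
  (forall t : R, (y <= t%:E)%E -> (x <= t%:E)%E) -> (x <= y)%E.
Proof.
case: y => [r|_|xr]; [exact | exact: leey |].
case: x xr => // [x /(_ (x - 1) (leNye _))|/(_ 0 (leNye _))//].
by rewrite lee_fin lerBrDl gerDr ler10.
Qed.

Variables (M : R -> \bar R) (G : R -> R).
Hypothesis G01 : forall t, 0 <= G t <= 1.
Hypothesis adj : forall y t, (M y <= t%:E)%E = (y <= G t).
Hypothesis Mfin : forall y, 0 < y < 1 -> M y \is a fin_num.

Lemma galois_homo : {homo M : x y / x <= y >-> (x <= y)%E}.
Proof.
by move=> x y xy; apply: lee_ubounds => t; rewrite !adj; exact: le_trans.
Qed.

(** Inverse transform sampling. The law is the image of the uniform law by [M];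
    since [M y <= t <-> y <= G t], its distribution function at [t] is the
    length of the part of [`]0, 1[] below [G t], that is [G t], and [M] is then
    its quantile function because both have the same adjoint. *)
Lemma law_of_galois : exists Q : law R, lquantile Q =1 M /\
  forall f : R -> \bar R, measurable_fun [set: R] f -> (forall x, 0 <= f x)%E ->
  (\int[Q]_x f x = \int[mu]_(y in `]0%R, 1%R[) f (fine (M y)))%E.
Proof.
have mX : measurable_fun [set: R] (fine \o M).
  by apply: measurableT_comp => //; exact: nondecreasing_emeasurable galois_homo.
pose U := uniform_prob (@ltr01 R).
(* [law R] is defined on [measurableTypeR R], whose display is not the one of
   [R]; both carry the same sigma-algebra. *)
pose F : measurableTypeR R -> measurableTypeR R := fine \o M.
have mF : measurable_fun [set: measurableTypeR R] F by exact: mX.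
pose X : {RV U >-> measurableTypeR R} :=
  HB.pack F (isMeasurableFun.Build _ _ _ _ F mF).
exists (distribution U X).
have intQ (f : R -> \bar R) : measurable_fun [set: R] f -> (forall x, 0 <= f x)%E ->
    (\int[distribution U X]_x f x = \int[mu]_(y in `]0%R, 1%R[) f (fine (M y)))%E.
  move=> mf f0.
  have mfM : measurable_fun [set: R] (f \o (fine \o M)) by exact: measurableT_comp.
  rewrite ge0_integral_distribution//.
  rewrite integral_uniform//; last by move=> x; exact: f0.
  rewrite subr0 invr1 mul1e.
  by rewrite integral_itv_bndoo//; exact/measurable_funTS.
have cdfQ t : cdf_of (distribution U X) t = G t.
  pose I : set R := `]-oo, t]%classic.
  transitivity (fine (\int[distribution U X]_x (\1_I x)%:E)).
    have mI : measurable (I : set (measurableTypeR R)) by exact: measurable_itv.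
    by rewrite integral_indic// (setIT I).
  rewrite intQ//; last first.
    by apply/measurable_EFinP/measurable_indic; exact: measurable_itv.
  have /andP[G0 G1] := G01 t.
  transitivity (fine (\int[mu]_(y in `]0%R, 1%R[) (\1_`]-oo, G t] y)%:E)).
    congr fine; apply: eq_integral => y; rewrite inE/= in_itv/= => y01.
    rewrite !indicE /I; congr ((nat_of_bool _)%:R)%:E.
    apply/idP/idP; rewrite !inE/= !in_itv/= -adj -lee_fin fineK//; exact: Mfin.
  rewrite integral_indic//.
  (* The level set is open on the right exactly when [G t = 1]. *)
  have [G1'|G1'] := ltP (G t) 1.
    rewrite (_ : _ `&` _ = `]0, G t]%classic).
      rewrite [X in fine X]lebesgue_measure_itv/= lte_fin.
      case: ltP => [_|G0']; first by rewrite oppr0 addr0.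
      by apply/eqP; rewrite eq_le G0 G0'.
    apply/seteqP; split=> x /=; rewrite !in_itv/=; first by case=> -> /andP[->].
    by move=> /andP[-> xG]; rewrite xG (le_lt_trans xG).
  have G1E : G t = 1 by apply/eqP; rewrite eq_le G1.
  rewrite G1E (_ : _ `&` _ = `]0, 1[%classic).
    by rewrite [X in fine X]lebesgue_measure_itv/= lte_fin ltr01 oppr0 addr0.
  apply/seteqP; split=> x /=; rewrite !in_itv/=; first by case.
  by move=> /andP[-> x1]; rewrite x1 ltW.
split=> [y|]; last exact: intQ.
apply/eqP.
by rewrite eq_le; apply/andP; split; apply: lee_ubounds => t;
  rewrite lquantile_le adj cdfQ.
Qed.
End law_of_galois.

(** * Quantile functions on the open unit interval *)

Section quantile_functions.
Context {R : realType} (P : law R).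
Local Notation mu := (@lebesgue_measure R).
Local Notation F := (cdf_of P).
Local Notation q := (fun y => fine (lquantile P y)).

Lemma lquantile_inj (Q : law R) : lquantile Q =1 lquantile P ->
  forall A, measurable A -> Q A = P A.
Proof.
move=> QP; apply: law_eq => t; apply/eqP; rewrite eq_le; apply/andP; split.
  by rewrite -lquantile_le -QP lquantile_le.
by rewrite -lquantile_le QP lquantile_le.
Qed.

(** Change of variables: by uniqueness of the law with a given quantile
    function, [law_of_galois] applied to the quantile of [P] returns [P]. *)
Lemma integral_lquantile (f : R -> \bar R) :
  measurable_fun [set: R] f -> (forall x, 0 <= f x)%E ->
  (\int[mu]_(y in `]0%R, 1%R[) f (q y) = \int[P]_x f x)%E.
Proof.
move=> mf f0.
have [|y t|y y01|Q [QP intQ]] := @law_of_galois R (lquantile P) F.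
- by move=> t; rewrite cdf_of_ge0 cdf_of_le1.
- exact: lquantile_le.
- exact: lquantile_fin_num.
rewrite -intQ//; apply: eq_measure_integral => A mA _; exact: lquantile_inj.
Qed.

Lemma measurable_fine_lquantile : measurable_fun [set: R] q.
Proof.
suff : measurable_fun [set: R] (fine \o lquantile P) by [].
apply: measurableT_comp => //.
exact: (nondecreasing_emeasurable (@lquantile_homo _ P)).
Qed.

Lemma measurable_fine_rquantile :
  measurable_fun [set: R] (fun y => fine (rquantile P y)).
Proof.
suff : measurable_fun [set: R] (fine \o rquantile P) by [].
apply: measurableT_comp => //.
exact: (nondecreasing_emeasurable (@rquantile_homo _ P)).
Qed.

Lemma fine_lquantile_le (y t : R) : 0 < y < 1 -> (q y <= t) = (y <= F t).
Proof. by move=> y01; rewrite -lquantile_le -lee_fin fineK// lquantile_fin_num. Qed.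

Lemma left_cont_nondecr_lquantile : left_cont_nondecr q.
Proof.
have q_nd : {in `]0, 1[ &, {homo q : x y / x <= y}}.
  move=> x y; rewrite !in_itv/= => x01 y01 xy.
  by rewrite fine_le ?lquantile_fin_num// lquantile_homo.
split=> // a a01; apply/cvgrPdist_lt => e e0.
have a01' : 0 < a < 1 by rewrite in_itv in a01.
have /andP[a0 a1] := a01'.
have Fa : F (q a - e) < a by rewrite ltNge -fine_lquantile_le// -ltNge gtrBl.
near=> x.
have xa : x < a by near: x; exact: nbhs_left_lt.
have x0 : 0 < x by near: x; exact: nbhs_left_gt.
have x1 : x < 1 by rewrite (lt_trans xa).
rewrite ger0_norm; last by rewrite subr_ge0 q_nd ?in_itv/= ?x0// ltW.
rewrite ltrBlDr -ltrBlDl ltNge fine_lquantile_le ?x0// -ltNge.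
by near: x; exact: nbhs_left_gt.
Unshelve. all: by end_near. Qed.

(** The objective is stated with the right quantile, while the truncation is
    applied to the left-continuous one; they agree almost everywhere. *)
Lemma objectiveE (L : R -> R) : measurable_fun (`]0, 1[%classic : set R) L ->
  (objective P L = \int[mu]_(y in `]0%R, 1%R[) ((L y - q y) ^+ 2)%:E)%E.
Proof.
move=> mL; have mD : measurable (`]0, 1[%classic : set R) by exact: measurable_itv.
apply: ge0_ae_eq_integral => //.
- apply/measurable_EFinP/measurable_funX/measurable_funB => //.
  by apply: measurable_funTS; exact: measurable_fine_rquantile.
- apply/measurable_EFinP/measurable_funX/measurable_funB => //.
  by apply: measurable_funTS; exact: measurable_fine_lquantile.
- by move=> x _; rewrite lee_fin sqr_ge0.
- by move=> x _; rewrite lee_fin sqr_ge0.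
- have [N [mN N0 qN]] := ae_lquantile_rquantile P.
  exists N; split=> // y /= neq; apply: qN => /= qE.
  by apply: neq => _; rewrite qE.
Qed.

End quantile_functions.

(** * Projection in the square-integrable functions *)

Section projection.
Context {R : realType}.
Local Notation mu := (@lebesgue_measure R).
Local Notation D := (`]0, 1[%classic : set R).
Implicit Types f g h : R -> R.

(** From [(u - v)^2 <= 2 u^2 + 2 v^2], the difference of the two sides being
    [(u + v)^2]. *)
Lemma square_integrable01B f g :
  square_integrable01 f -> square_integrable01 g ->
  (\int[mu]_(x in D) ((f x - g x) ^+ 2)%:E < +oo)%E.
Proof.
move=> [mf f2] [mg g2].
have mD : measurable D by exact: measurable_itv.
apply: (@le_lt_trans _ _ (2%:E * \int[mu]_(x in D) (f x ^+ 2)%:E +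
                          2%:E * \int[mu]_(x in D) (g x ^+ 2)%:E)%E).
  have m2 (h : R -> R) : measurable_fun D h -> measurable_fun D (fun x => (h x ^+ 2)%:E).
    by move=> mh; exact/measurable_EFinP/measurable_funX.
  rewrite -!ge0_integralZl//; last 4 first.
  - exact: m2.
  - by move=> x _; rewrite lee_fin sqr_ge0.
  - exact: m2.
  - by move=> x _; rewrite lee_fin sqr_ge0.
  rewrite -ge0_integralD//; last 4 first.
  - by move=> x _; rewrite -EFinM lee_fin mulr_ge0// sqr_ge0.
  - by apply: emeasurable_funM => //; exact: m2.
  - by move=> x _; rewrite -EFinM lee_fin mulr_ge0// sqr_ge0.
  - by apply: emeasurable_funM => //; exact: m2.
  apply: ge0_le_integral => //.
  - by move=> x _; rewrite lee_fin sqr_ge0.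
  - by apply: m2; exact: measurable_funB.
  - by apply: emeasurable_funD; apply: emeasurable_funM => //; exact: m2.
  - move=> x _; rewrite -!EFinM -EFinD lee_fin -subr_ge0.
    rewrite (_ : _ - _ = (f x + g x) ^+ 2) ?sqr_ge0//.
    ring.
by rewrite lte_add_pinfty// lte_mul_pinfty// lee_fin.
Qed.

(** The pointwise difference of the two sides is [2 (h - g) (g - f)], so an
    obtuse angle at every level suffices. *)
Lemma pythagoras_le f g h : measurable_fun D f -> measurable_fun D g ->
    measurable_fun D h ->
    (forall y, 0 < y < 1 -> 0 <= (h y - g y) * (g y - f y)) ->
  (\int[mu]_(x in D) ((g x - f x) ^+ 2)%:E +
   \int[mu]_(x in D) ((h x - g x) ^+ 2)%:E <=
   \int[mu]_(x in D) ((h x - f x) ^+ 2)%:E)%E.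
Proof.
move=> mf mg mh obtuse; have mD : measurable D by exact: measurable_itv.
have m2 (k l : R -> R) : measurable_fun D k -> measurable_fun D l ->
    measurable_fun D (fun x => ((k x - l x) ^+ 2)%:E).
  by move=> mk ml; exact/measurable_EFinP/measurable_funX/measurable_funB.
rewrite -ge0_integralD//; last 4 first.
- by move=> x _; rewrite lee_fin sqr_ge0.
- exact: m2.
- by move=> x _; rewrite lee_fin sqr_ge0.
- exact: m2.
apply: ge0_le_integral => //.
- by move=> x _; rewrite -EFinD lee_fin addr_ge0// sqr_ge0.
- by apply: emeasurable_funD; exact: m2.
- exact: m2.
- move=> y /=; rewrite in_itv/= => /obtuse hgf; rewrite -EFinD lee_fin -subr_ge0.
  rewrite (_ : _ - _ = 2 * ((h y - g y) * (g y - f y))); first by rewrite mulr_ge0.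
  ring.
Qed.

Lemma integral_sqrB_eq0 f g : measurable_fun D f -> measurable_fun D g ->
  (\int[mu]_(x in D) ((f x - g x) ^+ 2)%:E = 0)%E ->
  {ae mu, forall y, D y -> f y = g y}.
Proof.
move=> mf mg fg0; have mD : measurable D by exact: measurable_itv.
have : (\int[mu]_(x in D) `|((f x - g x) ^+ 2)%:E| = 0)%E.
  rewrite -[RHS]fg0; apply: eq_integral => x _.
  by rewrite gee0_abs// lee_fin sqr_ge0.
move=> /ae_eq_integral_abs => /(_ mD) ae0.
have [] := ae0; first exact/measurable_EFinP/measurable_funX/measurable_funB.
move=> N [mN N0 fgN]; exists N; split=> // y /= neq; apply: fgN => /= sq0.
apply: neq => /sq0 /= [] /eqP; rewrite sqrf_eq0 subr_eq0; exact/eqP.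
Qed.

(** If [f a != g a], then by left-continuity [f] and [g] differ on a whole
    interval ending at [a], which has positive length. *)
Lemma ae_eq_left_cont f g :
  {in `]0, 1[, forall a : R, f x @[x --> a^'-] --> f a} ->
  {in `]0, 1[, forall a : R, g x @[x --> a^'-] --> g a} ->
  {ae mu, forall y, D y -> f y = g y} -> {in `]0, 1[, f =1 g}.
Proof.
move=> fc gc [N [mN N0 fgN]] a a01; apply/eqP/negPn/negP => fga.
have : \forall x \near a^'-, f x - g x != 0.
  have : f x - g x @[x --> a^'-] --> f a - g a by apply: cvgB; [exact: fc|exact: gc].
  by move=> /cvgr_neq0; apply; rewrite subr_eq0.
move=> [e /= e0 fgx]; pose b := Num.max (a - e) 0.
have /andP[a0 a1] : 0 < a < 1 by rewrite in_itv in a01.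
have ba : b < a by rewrite gt_max gtrBl e0.
have baN : `]b, a[%classic `<=` N.
  move=> x /=; rewrite in_itv/= gt_max => /andP[/andP[aex x0] xa].
  apply: fgN => /= fgD; have := fgx x; rewrite /= ltr_distlC => fgx'.
  have : f x - g x != 0 by apply: fgx' => //; rewrite aex ltr_pwDr// ltW.
  by rewrite subr_eq0 fgD ?eqxx//= in_itv/= x0 (lt_trans xa).
have : (mu `]b, a[%classic <= mu N)%E by rewrite le_measure// inE//; exact: measurable_itv.
by rewrite N0 lebesgue_measure_itv/= lte_fin ba -EFinB lee_fin subr_le0 leNgt ba.
Qed.

End projection.

(** * Truncated quantiles *)

Section clamp.
Context {R : realType} (P : law R) (K : nat) (alpha b : 'I_K -> R).
Hypothesis alpha01 : forall i, 0 <= alpha i <= 1.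
Hypothesis alpha_incr : forall i j : 'I_K, (i < j)%N -> alpha i < alpha j.
Hypothesis b_incr : forall i j : 'I_K, (i < j)%N -> b i < b j.
Local Notation F := (cdf_of P).

(** Every admissible function has to stay between [lower_bnd] and [upper_bnd]
    on [`]0, 1[]: monotonicity propagates each constraint to the right, resp.
    to the left, of its level. An infinite value means that no constraint
    acts from that side. *)
Definition lower_bnd (y : R) : \bar R :=
  \big[Order.max/-oo%E]_(i | alpha i < y) (b i)%:E.

Definition upper_bnd (y : R) : \bar R :=
  \big[Order.min/+oo%E]_(i | y <= alpha i) (b i)%:E.

Definition clamp (y : R) : \bar R :=
  Order.max (lower_bnd y) (Order.min (lquantile P y) (upper_bnd y)).

(** The upper adjoint of [clamp], obtained by solving [clamp y <= t] for [y]: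
    all the constraints with [t < b i] must have [y <= alpha i], and either
    [y <= F t] or some constraint with [b i <= t] has [y <= alpha i]. The
    default value 1 of the minimum bounds nothing, as the other argument is at
    most 1. *)
Definition clamp_cdf (t : R) : R :=
  Num.min (\big[Num.min/1]_(i | t < b i) alpha i)
          (\big[Num.max/F t]_(i | b i <= t) alpha i).

Lemma alpha_mono i j : (alpha i < alpha j) = (i < j)%N.
Proof.
have [ij|ji|/val_inj ->] := ltngtP i j; [exact: alpha_incr| |by rewrite ltxx].
by apply/negbTE; rewrite -leNgt ltW// alpha_incr.
Qed.

Lemma b_mono i j : (b i < b j) = (i < j)%N.
Proof.
have [ij|ji|/val_inj ->] := ltngtP i j; [exact: b_incr| |by rewrite ltxx].
by apply/negbTE; rewrite -leNgt ltW// b_incr.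
Qed.

Lemma b_mono_le i j : (b i <= b j) = (i <= j)%N.
Proof. by rewrite leNgt b_mono -leqNgt. Qed.

Lemma lower_bnd_le (y : R) (z : \bar R) :
  (lower_bnd y <= z)%E <-> (forall i, alpha i < y -> ((b i)%:E <= z)%E).
Proof.
split=> [/bigmax_leP[_ +] i|bz]; first exact.
by apply/bigmax_leP; split=> //; exact: leNye.
Qed.

Lemma upper_bnd_ge (y : R) (z : \bar R) :
  (z <= upper_bnd y)%E <-> (forall i, y <= alpha i -> (z <= (b i)%:E)%E).
Proof.
split=> [/bigmin_geP[_ +] i|bz]; first exact.
by apply/bigmin_geP; split=> //; exact: leey.
Qed.

Lemma lower_le_upper (y : R) : (lower_bnd y <= upper_bnd y)%E.
Proof.
apply/lower_bnd_le => i aiy; apply/upper_bnd_ge => j yaj.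
by rewrite lee_fin b_mono_le -ltnS ltnW// ltnS -alpha_mono (lt_le_trans aiy).
Qed.

Lemma clamp_ge (y : R) : (lower_bnd y <= clamp y)%E.
Proof. by rewrite /clamp le_max lexx. Qed.

Lemma clamp_le (y : R) : (clamp y <= upper_bnd y)%E.
Proof. by rewrite /clamp ge_max lower_le_upper ge_min lexx orbT. Qed.

Lemma clamp_gt_lquantile (y : R) :
  (lquantile P y < clamp y)%E -> clamp y = lower_bnd y.
Proof.
rewrite /clamp; case: (leP (lower_bnd y)) => // _.
by rewrite lt_min ltxx.
Qed.

Lemma clamp_lt_lquantile (y : R) :
  (clamp y < lquantile P y)%E -> clamp y = upper_bnd y.
Proof.
rewrite {1}/clamp gt_max gt_min ltxx/= => /andP[_ ux].
rewrite /clamp (min_idPr (ltW ux)); apply/max_idPr; exact: lower_le_upper.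
Qed.

Lemma clamp_galois (y t : R) : (clamp y <= t%:E)%E = (y <= clamp_cdf t).
Proof.
rewrite /clamp ge_max ge_min lquantile_le /clamp_cdf le_min.
apply/andP/andP => [[lowt xt]|[+ +]].
  have yub : y <= \big[Num.max/F t]_(i | b i <= t) alpha i.
    apply/bigmax_geP; case/orP: xt => [yF|/bigmin_leP[//|[i yi]]]; first by left.
    by rewrite lee_fin => bt; right; exists i.
  split=> //; apply/bigmin_geP; split; last first.
    move=> i tb; rewrite leNgt; apply/negP => aiy.
    by have := (lower_bnd_le y t%:E).1 lowt i aiy; rewrite lee_fin leNgt tb.
  apply: (le_trans yub); apply/bigmax_leP; split; first exact: cdf_of_le1.
  by move=> i _; case/andP: (alpha01 i).
move=> /bigmin_geP[y1 lowt] /bigmax_geP ub; split.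
  apply/lower_bnd_le => i aiy; rewrite lee_fin leNgt; apply/negP => /lowt.
  by rewrite leNgt aiy.
apply/orP; case: ub => [->|[i bt yi]]; [by left|right].
by apply/bigmin_leP; right; exists i.
Qed.

Lemma clamp_cdf01 (t : R) : 0 <= clamp_cdf t <= 1.
Proof.
rewrite /clamp_cdf le_min ge_min; apply/andP; split.
  apply/andP; split.
    by apply/bigmin_geP; split=> // i _; case/andP: (alpha01 i).
  by apply/bigmax_geP; left; exact: cdf_of_ge0.
by apply/orP; left; apply/bigmin_leP; left.
Qed.

Lemma val_ord_pred (i : 'I_K) : i != 0 :> nat -> ord_pred i = i.-1 :> nat.
Proof.
move=> i0 /=; rewrite -subn1 addnC -addnBA ?lt0n// modnDl subn1.
by rewrite modn_small// (leq_ltn_trans (leq_pred _)).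
Qed.

Lemma val_ordS (i : 'I_K) : i.+1 != K -> ordS i = i.+1 :> nat.
Proof. by move=> iK /=; rewrite modn_small// ltn_neqAle iK ltn_ord. Qed.

(** If [c_i < y <= alpha i], the definition of [c_i] gives [F (b i) < y] and
    [alpha j < y] for [j < i]: the quantile of [P] exceeds [b i], which is the
    upper bound. If [alpha i < y <= d_i], then [y <= F (b i)] and
    [y <= alpha j] for [j > i]: the quantile is at most [b i], which is the
    lower bound. *)
Lemma clamp_eq_b (y : R) i : Aset P alpha b i y -> clamp y = (b i)%:E.
Proof.
rewrite /Aset /= in_itv/= => /andP[cy yd].
have [yai|aiy] := leP y (alpha i).
  have pred_lt (j : 'I_K) : (j < i)%N -> alpha j < y.
    move=> ji; move: (cy); rewrite /lower_end.
    case: ifPn => [/eqP i0|i0]; first by rewrite i0 in ji.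
    rewrite gt_min (ltNge (alpha i)) yai orbF gt_max => /andP[+ _].
    apply: le_lt_trans; rewrite leNgt alpha_mono -leqNgt val_ord_pred//.
    by rewrite -ltnS prednK// lt0n.
  have Fb : F (b i) < y.
    move: (cy); rewrite /lower_end.
    by case: ifPn => _; rewrite gt_min (ltNge (alpha i)) yai orbF// gt_max => /andP[].
  apply/eqP; rewrite eq_le; apply/andP; split.
    apply: (le_trans (clamp_le y)); exact: (upper_bnd_ge _ _).1 (lexx _) i yai.
  rewrite /clamp le_max le_min; apply/orP; right; apply/andP; split.
    by rewrite ltW// ltNge lquantile_le -ltNge.
  apply/upper_bnd_ge => j yaj; rewrite lee_fin b_mono_le leqNgt.
  by apply/negP => /pred_lt; rewrite ltNge yaj.
have succ_ge (j : 'I_K) : (i < j)%N -> y <= alpha j.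
  move=> ij; move: (yd); rewrite /upper_end.
  case: ifPn => [/eqP i0|i0].
    by have := leq_ltn_trans ij (ltn_ord j); rewrite i0 ltnn.
  rewrite le_max (leNgt _ (alpha i)) aiy orbF le_min => /andP[_].
  by move=> /le_trans; apply; rewrite leNgt alpha_mono -leqNgt val_ordS.
have Fb : y <= F (b i).
  move: (yd); rewrite /upper_end.
  by case: ifPn => _; rewrite le_max (leNgt _ (alpha i)) aiy orbF// le_min => /andP[].
apply/eqP; rewrite eq_le; apply/andP; split.
  rewrite /clamp ge_max ge_min lquantile_le Fb/= andbT.
  apply/lower_bnd_le => j ajy; rewrite lee_fin b_mono_le leqNgt.
  by apply/negP => /succ_ge; rewrite leNgt ajy.
by apply: le_trans (clamp_ge y); exact: (lower_bnd_le _ _).1 (lexx _) i aiy.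
Qed.

(** If truncation moves the quantile, the bound it hits is violated by some
    constraint; the violated constraint nearest to [y] is an index [i] with
    [y] in [A_i]. *)
Lemma clamp_eq_lquantile (y : R) : ~ (\bigcup_i Aset P alpha b i) y ->
  clamp y = lquantile P y.
Proof.
move=> yA; have [cq|qc|//] := ltgtP (clamp y) (lquantile P y); exfalso.
- have : ~ (lquantile P y <= upper_bnd y)%E.
    by apply/negP; rewrite -ltNge -clamp_lt_lquantile.
  move=> /upper_bnd_ge/existsNP[i0 /not_implyP[yai0 /negP]]; rewrite -ltNge => qb0.
  case: (@arg_minnP _ i0 (fun j => y <= alpha j) val yai0) => i yai imin.
  apply: yA; exists i => //; rewrite /Aset/= in_itv/=.
  have Fb : F (b i) < y.
    rewrite ltNge -lquantile_le -ltNge (le_lt_trans _ qb0)// lee_fin b_mono_le.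
    exact: imin.
  apply/andP; split; last first.
    by rewrite /upper_end; case: ifPn => _; rewrite le_max yai orbT.
  rewrite /lower_end; case: ifPn => i0'; first by rewrite gt_min Fb.
  rewrite gt_min gt_max Fb andbT ltNge; apply/orP; left; apply/negP => /imin.
  by rewrite [\val (ord_pred i)]val_ord_pred// leqNgt prednK ?lt0n// leqnn.
- have : ~ (lower_bnd y <= lquantile P y)%E.
    by apply/negP; rewrite -ltNge -clamp_gt_lquantile.
  move=> /lower_bnd_le/existsNP[i0 /not_implyP[ai0y /negP]]; rewrite -ltNge => qb0.
  case: (@arg_maxnP _ i0 (fun j => alpha j < y) val ai0y) => i aiy imax.
  apply: yA; exists i => //; rewrite /Aset/= in_itv/=.
  have Fb : y <= F (b i).
    rewrite -lquantile_le (le_trans (ltW qb0))// lee_fin b_mono_le.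
    exact: imax.
  apply/andP; split.
    by rewrite /lower_end; case: ifPn => _; rewrite gt_min aiy orbT.
  rewrite /upper_end; case: ifPn => iK; first by rewrite le_max Fb.
  rewrite le_max le_min Fb/= leNgt; apply/orP; left; apply/negP => /imax.
  move=> le_i; have : (ordS i <= i)%N by exact: le_i.
  by rewrite val_ordS// ltnn.
Qed.
End clamp.

(** * Admissible functions *)

Section one_sided_limits.
Context {R : realType} (L : R -> R).
Hypothesis L_nd : {in `]0, 1[ &, {homo L : x y / x <= y}}.

Lemma is_cvg_at_right (a : R) : 0 <= a < 1 -> cvg ((L x)%:E @[x --> a^'+]).
Proof.
move=> /andP[a0 a1]; apply: nondecreasing_at_right_is_cvge; near=> x.
have x1 : x <= 1 by near: x; exact: nbhs_right_le.
move=> s t; rewrite !in_itv/= => /andP[xs sa] /andP[xt ta] st.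
rewrite lee_fin L_nd// in_itv/=; apply/andP; split.
- exact: le_lt_trans xs.
- exact: lt_le_trans x1.
- exact: le_lt_trans xt.
- exact: lt_le_trans x1.
Unshelve. all: by end_near. Qed.

Lemma is_cvg_at_left1 : cvg ((L x)%:E @[x --> (1 : R)^'-]).
Proof.
suff : cvg ((L (- x))%:E @[x --> (- 1 : R)^'+]).
  by move=> /cvg_ex[/= l Ll]; apply/cvg_ex; exists l; exact/cvg_at_leftNP.
apply: nonincreasing_at_right_is_cvge; near=> x.
have x0 : x <= 0 by near: x; apply: nbhs_right_le; rewrite ltrN10.
move=> s t; rewrite !in_itv/= => /andP[xs sa] /andP[xt ta] st.
have t0 : t < 0 by exact: lt_le_trans x0.
have s0 : s < 0 by exact: lt_le_trans x0.
by rewrite lee_fin L_nd ?lerN2// in_itv/= oppr_gt0 ltrNl ?t0 ?s0.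
Unshelve. all: by end_near. Qed.

End one_sided_limits.

Section admissible.
Context {R : realType} (K : nat) (alpha b : 'I_K -> R).
Hypothesis alpha01 : forall i, 0 <= alpha i <= 1.
Local Notation lower := (lower_bnd alpha b).
Local Notation upper := (upper_bnd alpha b).

(** At the endpoint levels the conventional infinite values make one of the two
    constraints void, and the other one bounds a one-sided limit, which exists
    in the extended reals by monotonicity. *)
Lemma constraintsP (L : R -> R) : {in `]0, 1[ &, {homo L : x y / x <= y}} ->
  (forall i, (value_at L (alpha i) <= (b i)%:E)%E /\
             ((b i)%:E <= right_limit_at L (alpha i))%E) <->
  (forall y, 0 < y < 1 -> (lower y <= (L y)%:E <= upper y)%E).
Proof.
move=> L_nd; split=> [cL y y01|bL i].
  have /andP[y0 y1] := y01.
  apply/andP; split.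
    apply/lower_bnd_le => i aiy; have [_ bi] := cL i.
    have /andP[ai0 _] := alpha01 i.
    apply: (le_trans bi); rewrite /right_limit_at lt_eqF ?(lt_trans aiy)//.
    apply: lime_le; first by apply: is_cvg_at_right => //; rewrite ai0 (lt_trans aiy).
    near=> x; have xy : x < y by near: x; exact: nbhs_right_lt.
    rewrite lee_fin L_nd ?in_itv/= ?y01 ?(lt_trans xy)// ?(ltW xy)// andbT.
    by apply: (le_lt_trans ai0); near: x; exact: nbhs_right_gt.
  apply/upper_bnd_ge => i yai; have [bi _] := cL i.
  apply: le_trans bi; rewrite /value_at gt_eqF ?(lt_le_trans y0)//.
  case: ifPn => ai1; last first.
    have /andP[_ ai1'] := alpha01 i.
    by rewrite lee_fin L_nd// in_itv/= (lt_le_trans y0)// lt_neqAle ai1.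
  apply: lime_ge; first exact: is_cvg_at_left1.
  near=> x; have yx : y < x by near: x; exact: nbhs_left_gt.
  rewrite lee_fin L_nd ?in_itv/= ?y01 ?(lt_trans y0 yx) ?(ltW yx)//.
  by near: x; exact: nbhs_left_lt.
have /andP[ai0 ai1] := alpha01 i; split.
  rewrite /value_at; case: ifPn => [_|ai_n0]; first exact: leNye.
  case: ifPn => [/eqP aiE|ai_n1].
    apply: lime_le; first exact: is_cvg_at_left1.
    near=> x.
    have x0 : 0 < x by near: x; exact: nbhs_left_gt.
    have x1 : x < 1 by near: x; exact: nbhs_left_lt.
    have /andP[_ /upper_bnd_ge] : (lower x <= (L x)%:E <= upper x)%E by rewrite bL ?x0.
    by apply; rewrite aiE ltW.
  have /andP[_ /upper_bnd_ge] : (lower (alpha i) <= (L (alpha i))%:E <= upper (alpha i))%E.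
    by rewrite bL// lt_neqAle eq_sym ai_n0 ai0 lt_neqAle ai_n1.
  exact.
rewrite /right_limit_at; case: ifPn => [_|ai_n1]; first exact: leey.
have ai1' : alpha i < 1 by rewrite lt_neqAle ai_n1.
apply: lime_ge; first by apply: is_cvg_at_right => //; rewrite ai0.
near=> x.
have aix : alpha i < x by near: x; exact: nbhs_right_gt.
have x1 : x < 1 by near: x; exact: nbhs_right_lt.
have /andP[/lower_bnd_le + _] : (lower x <= (L x)%:E <= upper x)%E.
  by rewrite bL// x1 (le_lt_trans ai0).
exact.
Unshelve. all: by end_near. Qed.

End admissible.

(** * Optimality and uniqueness of the truncated quantile *)

Section clamp_optimal.
Context {R : realType} (P : law R) (K : nat) (alpha b : 'I_K -> R).
Hypothesis P2 : finite_second_moment P.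
Hypothesis alpha01 : forall i, 0 <= alpha i <= 1.
Hypothesis alpha_incr : forall i j : 'I_K, (i < j)%N -> alpha i < alpha j.
Hypothesis b_incr : forall i j : 'I_K, (i < j)%N -> b i < b j.
Local Notation mu := (@lebesgue_measure R).
Local Notation D := (`]0, 1[%classic : set R).
Local Notation q := (fun y => fine (lquantile P y)).
Local Notation clampP := (clamp P alpha b).

Lemma clamp_cases (y : R) :
  clampP y = lquantile P y \/ exists i, clampP y = (b i)%:E.
Proof.
have [[i _ yA]|yA] := pselect ((\bigcup_i Aset P alpha b i) y).
  by right; exists i; exact: clamp_eq_b yA.
by left; exact: clamp_eq_lquantile.
Qed.

Lemma clamp_fin_num (y : R) : 0 < y < 1 -> clampP y \is a fin_num.
Proof.
by case: (clamp_cases y) => [-> /lquantile_fin_num//|[i ->]].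
Qed.

Lemma law_of_clamp : exists Q : law R, lquantile Q =1 clampP.
Proof.
have [|y t|y y01|Q [QP _]] := @law_of_galois R clampP (clamp_cdf P alpha b).
- exact: clamp_cdf01.
- exact: clamp_galois.
- exact: clamp_fin_num.
by exists Q.
Qed.

Lemma square_integrable_lquantile : square_integrable01 q.
Proof.
split; first by apply: measurable_funTS; exact: measurable_fine_lquantile.
rewrite (@integral_lquantile _ P (fun x => (x ^+ 2)%:E))//.
- by apply/measurable_EFinP; exact: measurable_funX.
- by move=> x; rewrite lee_fin sqr_ge0.
Qed.

(** At each level the truncation is either the quantile of [P] or some [b i],
    hence its square is at most the sum of all their squares. *)
Lemma square_integrable_clamp (L : R -> R) : measurable_fun D L ->
  (forall y, 0 < y < 1 -> (L y)%:E = clampP y) -> square_integrable01 L.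
Proof.
move=> mL LE; split=> //.
have [mq q2] := square_integrable_lquantile.
have mD : measurable D by exact: measurable_itv.
have b2 : 0 <= \sum_i b i ^+ 2 by apply: sumr_ge0 => i _; exact: sqr_ge0.
have mq2 : measurable_fun D (fun y => (q y ^+ 2)%:E).
  exact/measurable_EFinP/measurable_funX.
apply: (@le_lt_trans _ _ (\int[mu]_(y in D) ((q y ^+ 2)%:E + (\sum_i b i ^+ 2)%:E))%E).
  apply: ge0_le_integral => //.
  - by move=> y _; rewrite lee_fin sqr_ge0.
  - exact/measurable_EFinP/measurable_funX.
  - exact: emeasurable_funD.
  - move=> y /=; rewrite in_itv/= => y01; rewrite -EFinD lee_fin.
    have := LE y y01; case: (clamp_cases y) => [->|[i ->]].
      by move=> /(congr1 fine)/= <-; rewrite lerDl.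
    move=> [->]; rewrite (bigD1 i)//= addrCA lerDl addr_ge0 ?sqr_ge0//.
    by apply: sumr_ge0 => j _; exact: sqr_ge0.
rewrite ge0_integralD//; last by move=> y _; rewrite lee_fin sqr_ge0.
apply: lte_add_pinfty => //.
change (\int[mu]_(y in D) cst (\sum_i b i ^+ 2)%:E y < +oo)%E.
rewrite integral_cst// [X in (_ * X)%E]lebesgue_measure_itv/= lte_fin ltr01.
by rewrite oppr0 adde0 mule1 ltry.
Qed.

Variable Q : law R.
Hypothesis QE : lquantile Q =1 clampP.
Local Notation L := (fun y => fine (lquantile Q y)).

Lemma EFin_clamp (y : R) : 0 < y < 1 -> (L y)%:E = clampP y.
Proof. by move=> y01; rewrite /= QE fineK// clamp_fin_num. Qed.

Lemma clamp_admissible : admissible alpha b L.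
Proof.
have LLC := left_cont_nondecr_lquantile Q.
split=> //.
  apply: square_integrable_clamp EFin_clamp.
  by apply: measurable_funTS; exact: measurable_fine_lquantile.
apply: (proj2 (@constraintsP _ _ alpha b alpha01 _ LLC.1)) => y y01.
by rewrite EFin_clamp// clamp_ge clamp_le.
Qed.

(** When truncation raises the quantile it does so up to [lower_bnd], which
    [L'] exceeds, and symmetrically with [upper_bnd]: the two factors have the
    same sign. *)
Lemma clamp_obtuse (L' : R -> R) : admissible alpha b L' ->
  forall y, 0 < y < 1 -> 0 <= (L' y - L y) * (L y - q y).
Proof.
move=> [_ [L'nd _] cL'] y y01.
have L'b := proj1 (@constraintsP _ _ alpha b alpha01 _ L'nd) cL'.
have /andP[lL' L'u] := L'b y y01.
have qE : (q y)%:E = lquantile P y by rewrite fineK// lquantile_fin_num.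
have LE := EFin_clamp y01.
have [qL|Lq|->] := ltgtP (q y) (L y); last by rewrite subrr mulr0.
- apply: mulr_ge0; last by rewrite subr_ge0 ltW.
  rewrite subr_ge0 -lee_fin LE clamp_gt_lquantile//.
  by rewrite -qE -LE lte_fin.
- apply: mulr_le0; last by rewrite subr_le0 ltW.
  rewrite subr_le0 -lee_fin LE clamp_lt_lquantile//.
  by rewrite -qE -LE lte_fin.
Qed.

Lemma clamp_pythagoras (L' : R -> R) : admissible alpha b L' ->
  (objective P L + \int[mu]_(y in D) ((L' y - L y) ^+ 2)%:E <= objective P L')%E.
Proof.
move=> aL'; have [[mL' _] _ _] := aL'; have [[mL _] _ _] := clamp_admissible.
rewrite !objectiveE//; apply: pythagoras_le => //; last exact: clamp_obtuse.
by apply: measurable_funTS; exact: measurable_fine_lquantile.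
Qed.

Lemma clamp_argmin : is_argmin P alpha b L.
Proof.
split; first exact: clamp_admissible.
move=> L' /clamp_pythagoras; apply: le_trans; rewrite leeDl//.
by apply: integral_ge0 => y _; rewrite lee_fin sqr_ge0.
Qed.

Lemma argmin_unique (L' : R -> R) :
  is_argmin P alpha b L' -> {in `]0, 1[, L' =1 L}.
Proof.
move=> [aL' L'min]; have aL := clamp_admissible.
have [sL [_ cL] _] := aL; have [sL' [_ cL'] _] := aL'.
apply: ae_eq_left_cont => //; apply: integral_sqrB_eq0; [by case: sL'|by case: sL|].
have oL : objective P L \is a fin_num.
  rewrite ge0_fin_numE; last by apply: integral_ge0 => y _; rewrite lee_fin sqr_ge0.
  rewrite objectiveE; last by case: sL.
  exact: square_integrable01B sL square_integrable_lquantile.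
apply/eqP; rewrite eq_le; apply/andP; split; last first.
  by apply: integral_ge0 => y _; rewrite lee_fin sqr_ge0.
have := le_trans (clamp_pythagoras aL') (L'min _ aL).
by rewrite -[leRHS]adde0 leeD2lE.
Qed.

End clamp_optimal.

Theorem proposition2 (R : realType) (P : law R)
    (P2 : finite_second_moment P)
    (K : nat) (K_gt0 : (0 < K)%N) (alpha b : 'I_K -> R)
    (alpha01 : forall i, 0 <= alpha i <= 1)
    (C_neq0 : perturbation_class alpha b !=set0)
    (alpha_incr : forall i j : 'I_K, (i < j)%N -> alpha i < alpha j)
    (b_incr : forall i j : 'I_K, (i < j)%N -> b i < b j) :
  exists Q : law R,
    let L x := fine (lquantile Q x) in
    [/\ is_argmin P alpha b L,
        forall L', is_argmin P alpha b L' -> {in `]0, 1[, L' =1 L},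
        {ae lebesgue_measure, forall y : R, `[0, 1]%classic y ->
           piecewise_at P alpha b (rquantile P) (lquantile Q) y} &
        forall y : R, `[0, 1]%classic y ->
           piecewise_at P alpha b (lquantile P) (lquantile Q) y].
Proof.
have [Q QE] := law_of_clamp P alpha01 alpha_incr b_incr.
have pieces y : piecewise_at P alpha b (lquantile P) (lquantile Q) y.
  split=> [yA|i yA]; rewrite QE.
    exact: clamp_eq_lquantile.
  exact: clamp_eq_b yA.
exists Q; split.
- exact: clamp_argmin.
- exact: argmin_unique.
- have [N [mN N0 qN]] := ae_lquantile_rquantile P.
  exists N; split=> // y /= npieces; apply: qN => /= qE.
  by apply: npieces => _; have [off on] := pieces y; split=> // /off; rewrite qE.
- by move=> y _.
Qed.
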